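(* Let $k=(k(n))_{n\ge 0}$ be a real sequence with $\sum_{n=0}^\infty |k(n)|<\infty$, and suppose that the solution $r$ of the resolvent equation $r(n+1)=\sum_{j=0}^{n}k(n-j)r(j)$, $n\ge 0$, $r(0)=1$, satisfies $\sum_{n=0}^\infty |r(n)|<\infty$. Let $H=(H(n))_{n\ge 0}$ be a real sequence, $\xi\in\mathbb{R}$, and let $x$ be the solution of $$x(n+1)=\sum_{j=0}^{n}k(n-j)x(j)+H(n+1),\quad n\ge 0;\qquad x(0)=\xi.$$ If $\phi:[0,\infty)\to[0,\infty)$ is an increasing, convex, and $O$-regularly varying function, then the following are equivalent: (a) $\displaystyle\limsup_{n\to\infty}\frac1n\sum_{j=0}^{n}\phi(|x(j)|)<\infty$; (b) $\displaystyle\limsup_{n\to\infty}\frac1n\sum_{j=0}^{n}\phi(|H(j)|)<\infty$.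
   Context: A nonnegative measurable function $\phi$ is called $O$-regularly varying if $0<\liminf_{x\to\infty}\frac{\phi(\lambda x)}{\phi(x)}\le\limsup_{x\to\infty}\frac{\phi(\lambda x)}{\phi(x)}<\infty$ for each $\lambda>1$. The value $H(0)$ does not enter the equation for $x$. *)

(* Defs.v *)
From mathcomp Require Import all_boot all_order all_algebra.
From mathcomp Require Import all_classical all_reals all_analysis.
Set Implicit Arguments.
Unset Strict Implicit.
Unset Printing Implicit Defensive.
Import Order.TTheory GRing.Theory Num.Theory.
Import numFieldNormedType.Exports.
Local Open Scope classical_set_scope.
Local Open Scope ring_scope.

(* A function on [0, +oo) is encoded as a total function R -> R of which only
   the restriction to [0, +oo) is constrained.
   Since x / 0 = 0, a positive lower limit forces phi to be eventually
   positive, so the quotients are genuine ones near +oo. *)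
Definition O_regularly_varying (R : realType) (phi : R -> R) : Prop :=
  [/\ forall u, 0 <= u -> 0 <= phi u,
      measurable_fun (`[0, +oo[%classic : set R) phi &
      forall lambda : R, 1 < lambda ->
        let ratio := fun u : R => (phi (lambda * u) / phi u)%:E in
        [/\ (0 < limf_einf ratio +oo%R)%E,
            (limf_einf ratio +oo%R <= limf_esup ratio +oo%R)%E &
            (limf_esup ratio +oo%R < +oo)%E]].

(* The value f 0 is not used. *)
Definition volterra_solution (R : realType) (k f : R^nat) (y0 : R)
    (y : R^nat) : Prop :=
  y 0%N = y0 /\
  forall n : nat,
    y n.+1 = \sum_(0 <= j < n.+1) k (n - j)%N * y j + f n.+1.

Definition resolvent (R : realType) (k r : R^nat) : Prop :=
  r 0%N = 1 /\
  forall n : nat, r n.+1 = \sum_(0 <= j < n.+1) k (n - j)%N * r j.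

(* The value at n = 0 (where n^-1 = 0) does not affect the upper limit. *)
Definition bounded_phi_mean (R : realType) (phi : R -> R) (y : R^nat) : Prop :=
  (limn_esup
     (fun n => (n%:R^-1 * \sum_(0 <= j < n.+1) phi `|y j|)%:E) < +oo)%E.

(* Main.v *)
Require Import Defs.
From mathcomp Require Import all_boot all_order all_algebra.
From mathcomp Require Import all_classical all_reals all_analysis.
From mathcomp Require Import lra.
Set Implicit Arguments.
Unset Strict Implicit.
Unset Printing Implicit Defensive.
Import Order.TTheory GRing.Theory Num.Theory.
Import numFieldNormedType.Exports.
Local Open Scope classical_set_scope.
Local Open Scope ring_scope.

(** Let [a = (1, - k 0, - k 1, ...)] be the Volterra kernel and write [*] for
the convolution of sequences.  The Volterra equation says that [a * x] agrees
with [H] from index 1 on, and the resolvent [r] is the convolution inverse of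
[a] ([resolventK]), so that [x = r * (a * x)].  Both [a] and [r] are summable.
Changing one term of a sequence does not change whether its [phi]-means are
bounded ([eq_bounded_phi_mean]), so that both implications reduce to one fact:
convolution with a summable sequence preserves boundedness of the [phi]-means
([bounded_phi_mean_convolution]).

For that fact, let [A] exceed the sum of the [`|a j|].  Then
[`|(a * y) n|] is at most [A] times a combination of the values [`|y j|] and
of 0, with the convex weights [`|a (n - j)| / A] and a remaining weight
on 0.  Regular variation removes the dilation: [phi (A * u) <= C * phi u + D]
for all [u >= 0] ([phi_scale_le]).  Jensen's inequality ([jensen_sum]) then
bounds [phi `|(a * y) n|] by a multiple of the convolution of [`|a|] with
[phi `|y|], plus a constant, and the sum over [n < N] of the former is at most
the product of the sums of its factors ([sum_convolution_le]), hence [O(N)]. *)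

(** * Convolution of sequences *)

Definition convolution (R : pzSemiRingType) (a y : nat -> R) (n : nat) : R :=
  \sum_(0 <= j < n.+1) a j * y (n - j)%N.

(** Truncating to polynomials transfers the commutativity and associativity of
their product to convolution, without any rearrangement of double sums. *)
Lemma convolution_coefM (R : nzSemiRingType) (a b : nat -> R) (N n : nat) :
  (n < N)%N ->
  convolution a b n = (\poly_(i < N) a i * \poly_(i < N) b i)`_n.
Proof.
move=> nN; rewrite coefM /convolution big_mkord; apply: eq_bigr => j _.
have jn : (j <= n)%N by rewrite -ltnS.
by rewrite !coef_poly (leq_ltn_trans jn nN) (leq_ltn_trans (leq_subr _ _) nN).
Qed.

Lemma convolutionC (R : comNzSemiRingType) (a b : nat -> R) :
  convolution a b =1 convolution b a.
Proof. by move=> n; rewrite !(@convolution_coefM _ _ _ n.+1)// mulrC. Qed.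

Lemma convolutionA (R : nzSemiRingType) (a b c : nat -> R) :
  convolution a (convolution b c) =1 convolution (convolution a b) c.
Proof.
move=> n.
have trunc (p : {poly R}) (f : nat -> R) :
    (forall i, (i < n.+1)%N -> f i = p`_i) ->
    forall i, (i < n.+1)%N -> (\poly_(i < n.+1) f i)`_i = p`_i.
  by move=> fp i iN; rewrite coef_poly iN fp.
rewrite !(@convolution_coefM _ _ _ n.+1)//.
transitivity ((\poly_(i < n.+1) a i *
    (\poly_(i < n.+1) b i * \poly_(i < n.+1) c i))`_n).
  rewrite !coefM; apply: eq_bigr => j _; congr (_ * _).
  apply: trunc; last by rewrite ltnS leq_subr.
  by move=> i iN; exact: convolution_coefM.
rewrite mulrA coefM [RHS]coefM; apply: eq_bigr => j _; congr (_ * _).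
apply/esym/trunc => // i iN; exact: convolution_coefM.
Qed.

Lemma convolution_delta (R : pzSemiRingType) (d y : nat -> R) :
  d 0%N = 1 -> (forall n, d n.+1 = 0) -> convolution d y =1 y.
Proof.
move=> d0 dS n; rewrite /convolution big_nat_recl// d0 mul1r subn0.
by rewrite big1 ?addr0// => j _; rewrite dS mul0r.
Qed.

(** The discrete form of Young's inequality for the 1-norm, on a finite
horizon: the terms on the left are those of the expanded product whose
indices add up to less than [N]. *)
Lemma sum_convolution_le (R : numDomainType) (a y : nat -> R) (N : nat) :
  (forall n, 0 <= a n) -> (forall n, 0 <= y n) ->
  \sum_(0 <= n < N) convolution a y n <=
    (\sum_(0 <= j < N) a j) * \sum_(0 <= i < N) y i.
Proof.
move=> a0 y0.
rewrite (eq_big_nat _ _ (F2 := fun n =>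
    \sum_(0 <= j < N | (j < n.+1)%N) a j * y (n - j)%N)); last first.
  by move=> n nN; rewrite /convolution (big_nat_widen 0 n.+1 N).
rewrite (exchange_big_dep_nat xpredT)//= mulr_suml.
apply: ler_sum_nat => j jN; rewrite -mulr_sumr; apply: ler_wpM2l => //.
rewrite -(big_nat_widenl j 0 N xpredT)// -{1}[j]add0n big_addn.
under eq_bigr do rewrite addnK.
rewrite [leRHS](big_cat_nat _ (n := (N - j)%N))//= ?leq_subr//.
by rewrite lerDl sumr_ge0.
Qed.

(** * The Volterra equation as a convolution equation *)

(** As a formal power series this is [1 - z * k(z)], so that
[convolution (volterra_kernel k) x] is, at positive indices, the
residual of the homogeneous equation. *)
Definition volterra_kernel (R : pzRingType) (k : nat -> R) (n : nat) : R :=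
  if n is m.+1 then - k m else 1.

Lemma convolution_volterra_kernel (R : pzRingType) (k y : nat -> R) (n : nat) :
  convolution (volterra_kernel k) y n.+1 =
    y n.+1 - \sum_(0 <= j < n.+1) k (n - j)%N * y j.
Proof.
rewrite /convolution big_nat_recl//= mul1r subn0; congr (_ + _).
rewrite [in RHS]big_nat_rev -sumrN; apply: eq_big_nat => j /andP[_ jn].
by rewrite add0n !subSS mulNr subKn.
Qed.

Lemma convolution_volterra_kernel0 (R : pzRingType) (k y : nat -> R) :
  convolution (volterra_kernel k) y 0 = y 0%N.
Proof. by rewrite /convolution big_nat1 mul1r. Qed.

(** By the resolvent equation, [r] is a solution with zero forcing and initial
value 1, that is, its convolution with the kernel is the unit sequence
(1, 0, 0, ...). *)
Lemma resolventK (R : realType) (k r y : R^nat) : resolvent k r ->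
  convolution r (convolution (volterra_kernel k) y) =1 y.
Proof.
move=> [r0 rS] n; rewrite convolutionA; apply: convolution_delta => [|m].
  by rewrite convolutionC convolution_volterra_kernel0.
by rewrite convolutionC convolution_volterra_kernel -rS subrr.
Qed.

Lemma volterra_solution_forcing (R : realType) (k f x : R^nat) (x0 : R) :
  volterra_solution k f x0 x ->
  forall n, convolution (volterra_kernel k) x n.+1 = f n.+1.
Proof.
by move=> [_ xS] n; rewrite convolution_volterra_kernel xS addrAC subrr add0r.
Qed.

Lemma abs_summable_bounded (R : realType) (a : R^nat) :
  (\sum_(0 <= n <oo) `|a n|%:E < +oo)%E ->
  exists B, forall n, \sum_(0 <= j < n) `|a j| <= B.
Proof.
move=> afin; exists (fine (\sum_(0 <= n <oo) `|a n|%:E)%E) => n.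
rewrite -lee_fin fineK; last first.
  by rewrite ge0_fin_numE// nneseries_ge0// => i _ _; rewrite lee_fin.
rewrite -sumEFin; apply: nneseries_lim_ge => i _ _.
by rewrite lee_fin.
Qed.

Lemma volterra_kernel_bounded (R : realType) (k : R^nat) (B : R) :
  (forall n, \sum_(0 <= j < n) `|k j| <= B) ->
  forall n, \sum_(0 <= j < n) `|volterra_kernel k j| <= 1 + B.
Proof.
move=> kB [|n].
  by have := kB 0%N; rewrite !big_geq// => B0; rewrite addr_ge0.
rewrite big_nat_recl//= normr1 lerD2l.
by under eq_bigr do rewrite normrN.
Qed.

(** * Growth and convexity of the gauge function *)

Section PhiMeans.
Variables (R : realType) (phi : R -> R).
Hypothesis phi_ge0 : forall u, 0 <= u -> 0 <= phi u.
Hypothesis phi_incr : forall u v, 0 <= u -> u <= v -> phi u <= phi v.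
Hypothesis phi_convex : convex_function (`[0, +oo[%classic : set R) phi.

(** Convexity stated for unnormalized weights, that is, subadditivity of the
perspective function [(w, s) |-> w * phi (s / w)]: in this form it
can be iterated without renormalizing the weights at each step. *)
Lemma convex_perspective (p q u v : R) :
  0 < p -> 0 <= q -> 0 <= u -> 0 <= v ->
  (p + q) * phi ((p * u + q * v) / (p + q)) <= p * phi u + q * phi v.
Proof.
move=> p0 q0 u0 v0; have pq0 : 0 < p + q by rewrite ltr_pwDl.
have t01 : 0 <= p / (p + q) <= 1.
  by rewrite divr_ge0 ?(ltW p0) ?(ltW pq0)//= ler_pdivrMr// mul1r lerDl.
have /andP[t0 t1] := t01.
have /[!inE]/= /[!in_itv]/= /[!andbT] /(_ u0 v0) H :=
  @phi_convex (Itv01 t0 t1) u v.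
have {H} : phi (p / (p + q) * u + (1 - p / (p + q)) * v) <=
    p / (p + q) * phi u + (1 - p / (p + q)) * phi v := H.
have -> : 1 - p / (p + q) = q / (p + q).
  apply: (mulIf (lt0r_neq0 pq0)).
  by rewrite mulrBl mul1r !divfK ?gt_eqF// addrC addKr.
move=> H.
have -> : (p * u + q * v) / (p + q) = p / (p + q) * u + q / (p + q) * v.
  by rewrite mulrDl [p * u / _]mulrAC [q * v / _]mulrAC.
rewrite -ler_pdivlMl//; apply: (le_trans H).
by rewrite mulrDr !mulrA ![(p + q)^-1 * _]mulrC.
Qed.

(** Jensen's inequality with an additional point 0 of weight [e].  Its
positive weight keeps every partial sum of weights nonzero during the
induction, also when some [w j] vanish. *)
Lemma jensen_sum (e : R) (w t : nat -> R) (n : nat) :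
  0 < e -> (forall j, 0 <= w j) -> (forall j, 0 <= t j) ->
  (e + \sum_(0 <= j < n) w j) *
      phi ((\sum_(0 <= j < n) w j * t j) / (e + \sum_(0 <= j < n) w j)) <=
    e * phi 0 + \sum_(0 <= j < n) w j * phi (t j).
Proof.
move=> e0 w0 t0; elim: n => [|n IH].
  by rewrite !big_geq// mul0r !addr0.
rewrite !big_nat_recr//=.
set W := \sum_(0 <= j < n) w j in IH *.
set S := \sum_(0 <= j < n) w j * t j in IH *.
have W0 : 0 < e + W by rewrite ltr_wpDr// sumr_ge0.
have S0 : 0 <= S by apply: sumr_ge0 => j _; rewrite mulr_ge0.
have := convex_perspective W0 (w0 n) (divr_ge0 S0 (ltW W0)) (t0 n).
rewrite [_ * (S / _)]mulrC divfK ?gt_eqF// !addrA => /le_trans; apply.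
by rewrite lerD2r.
Qed.

(** The upper limit gives [phi (l * u) <= C * phi u] near infinity.  As
[x / 0 = 0], this needs [phi u != 0], which follows from the positive
lower limit.  On the remaining bounded interval monotonicity gives the
constant [D]. *)
Lemma phi_scale_le (l : R) : O_regularly_varying phi -> 1 < l ->
  exists C D, [/\ 0 <= C, 0 <= D &
    forall u, 0 <= u -> phi (l * u) <= C * phi u + D].
Proof.
move=> [_ _ /(_ l) orv] l1; have [inf0 _ supoo] := orv l1.
have l0 : 0 <= l by apply: le_trans (ltW l1).
have [X phi_neq0] : exists X, forall u, X < u -> phi u != 0.
  move: inf0; rewrite limf_einfE => /ereal_sup_gt[_ [V [X [_ XV]] <-] infV].
  exists X => u Xu; apply/eqP => phiu0.
  have : (ereal_inf [set (phi (l * x) / phi x)%:E | x in V] <=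
      (phi (l * u) / phi u)%:E)%E.
    by apply: ereal_inf_lbound; exists u => //; exact: XV.
  by rewrite phiu0 invr0 mulr0 leNgt infV.
have [Y [C ratio_le]] : exists Y C, forall u, Y < u -> phi (l * u) / phi u <= C.
  move: supoo; rewrite limf_esupE => /ereal_inf_lt[_ [V [Y [_ YV]] <-] supV].
  have ratio_sup u : Y < u -> ((phi (l * u) / phi u)%:E <=
      ereal_sup [set (phi (l * x) / phi x)%:E | x in V])%E.
    by move=> Yu; apply: ereal_sup_ubound; exists u => //; exact: YV.
  exists Y; move: supV ratio_sup; case: (ereal_sup _) => [c|//|] _ ratio_sup.
    by exists c => u /ratio_sup; rewrite lee_fin.
  by exists 0 => u /ratio_sup; rewrite leeNy_eq.
pose Z := Num.max 0 (Num.max X Y).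
have Z0 : 0 <= Z by rewrite le_max lexx.
exists (Num.max 0 C), (phi (l * Z)); split.
- by rewrite le_max lexx.
- by rewrite phi_ge0// mulr_ge0.
move=> u u0; have [uZ|Zu] := leP u Z.
  rewrite ler_wpDl//; last by rewrite phi_incr// ?mulr_ge0// ler_wpM2l.
  by rewrite mulr_ge0 ?le_max ?lexx// phi_ge0.
have [Xu Yu] : X < u /\ Y < u.
  by move: Zu; rewrite !gt_max => /and3P[].
have phiu0 : 0 < phi u by rewrite lt_def phi_neq0// phi_ge0.
rewrite ler_wpDr// ?phi_ge0 ?mulr_ge0//.
by rewrite -ler_pdivrMr// le_max ratio_le// orbT.
Qed.

(** * Sequences with bounded means *)

(** A form without limits: finitely many sums are absorbed into
the constant. *)
Lemma bounded_phi_meanP (y : R^nat) :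
  bounded_phi_mean phi y <->
  exists M, forall n, \sum_(0 <= j < n) phi `|y j| <= M * n%:R.
Proof.
pose S n := \sum_(0 <= j < n) phi `|y j|.
have S_ge0 n : 0 <= S n by apply: sumr_ge0 => j _; exact: phi_ge0.
have S_mono m n : (m <= n)%N -> S m <= S n.
  move=> mn; rewrite /S (big_cat_nat _ mn)//= lerDl sumr_ge0// => j _.
  exact: phi_ge0.
rewrite /bounded_phi_mean /limn_esup limf_esupE; split; last first.
  move=> [M SM]; apply: (@le_lt_trans _ _ (2 * M)%:E); last exact: ltry.
  (* The sum has n + 1 terms and is divided by n, whence the factor 2. *)
  apply: ereal_inf_le; eexists.
    by exists [set n | (0 < n)%N] => //; exists 1%N.
  apply: ge_ereal_sup => _ [[//|n] _ <-]; rewrite lee_fin ler_pdivrMl//.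
  have M0 : 0 <= M by have := SM 1%N; rewrite mulr1; exact: le_trans (S_ge0 1%N).
  apply: (le_trans (SM n.+2)); rewrite mulrA [leRHS]mulrC ler_wpM2l//.
  by rewrite -natrM ler_nat muln2 -addnn addnS addSn !ltnS leq_addl.
move=> /ereal_inf_lt[_ [V [m _ mV] <-]].
set s := ereal_sup _ => soo.
have [c [c0 Sc]] : exists c, 0 <= c /\
    forall n, (m < n)%N -> S n.+1 <= c * n%:R.
  exists (Num.max 0 (fine s)); split; first by rewrite le_max lexx.
  move=> n mn; have n0 : (0 < n%:R :> R) by rewrite ltr0n (leq_ltn_trans _ mn).
  have : ((n%:R^-1 * S n.+1)%:E <= s)%E.
    by apply: ereal_sup_ubound; exists n => //; apply: mV; exact: ltnW.
  have : (0 <= (n%:R^-1 * S n.+1)%:E)%E by rewrite lee_fin mulr_ge0.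
  move: soo; case: s => [s _ _|//|_ _]; last by rewrite leeNy_eq.
  rewrite lee_fin ler_pdivrMl// mulrC => /le_trans; apply.
  by rewrite ler_wpM2r// le_max lexx orbT.
exists (c + S m.+2) => -[|n]; first by rewrite big_geq// mulr0.
rewrite -/(S _) mulrDl; have [mn|nm] := ltnP m n.
  rewrite (le_trans (Sc _ mn))// ler_wpDr ?mulr_ge0// ler_wpM2l// ler_nat.
  exact: leqnSn.
rewrite ler_wpDl ?mulr_ge0//; apply: (@le_trans _ _ (S m.+2)).
  by apply: S_mono; rewrite ltnS leqW.
by rewrite ler_peMr// ler1n.
Qed.

Lemma eq_bounded_phi_mean (y z : R^nat) : (forall n, y n.+1 = z n.+1) ->
  bounded_phi_mean phi y -> bounded_phi_mean phi z.
Proof.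
move=> yz /bounded_phi_meanP[M yM]; apply/bounded_phi_meanP.
exists (M + phi `|z 0%N|) => -[|n]; first by rewrite big_geq// mulr0.
have z0M : phi `|z 0%N| <= phi `|z 0%N| * n.+1%:R.
  by rewrite ler_peMr ?phi_ge0// ler1n.
rewrite mulrDl; apply: le_trans (lerD (yM n.+1) z0M).
rewrite !big_nat_recl// [leRHS]addrC lerD2l ler_wpDl ?phi_ge0//.
by under eq_bigr do rewrite -yz.
Qed.

(** Jensen's inequality and regular variation bound the composition with [phi]
pointwise; summation then costs only the factor [B]. *)
Lemma bounded_phi_mean_convolution (a y : R^nat) (B : R) :
  O_regularly_varying phi ->
  (forall n, \sum_(0 <= j < n) `|a j| <= B) ->
  bounded_phi_mean phi y -> bounded_phi_mean phi (convolution a y).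
Proof.
move=> orv aB /bounded_phi_meanP[M yM]; apply/bounded_phi_meanP.
have B0 : 0 <= B by have := aB 0%N; rewrite big_geq.
(* A must be a dilation factor above 1 and exceed all sums of weights. *)
pose A := B + 2; have A0 : 0 < A by rewrite /A; lra.
have A1 : 1 < A by rewrite /A; lra.
have [C [D [C0 D0 phiA]]] := phi_scale_le orv A1.
pose p n := phi `|y n|.
have p0 n : 0 <= p n by exact: phi_ge0.
have pointwise n : phi `|convolution a y n| <=
    C / A * convolution (fun j => `|a j|) p n + (C * phi 0 + D).
  (* The weight A - W that the coefficients leave over is put on 0. *)
  set W := \sum_(0 <= j < n.+1) `|a j|.
  have WB : W <= B := aB n.+1.
  have W0 : 0 <= W by apply: sumr_ge0.
  have e0 : 0 < A - W by rewrite /A; lra.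
  have := @jensen_sum (A - W) (fun j => `|a j|) (fun j => `|y (n - j)%N|) n.+1
    e0 (fun=> normr_ge0 _) (fun=> normr_ge0 _).
  rewrite -/W subrK; set T := \sum_(0 <= j < n.+1) `|a j| * `|_|.
  rewrite -/(convolution (fun j => `|a j|) p n).
  have T0 : 0 <= T by apply: sumr_ge0 => j _; rewrite mulr_ge0.
  move=> jensen.
  have yT : `|convolution a y n| <= T.
    rewrite (le_trans (ler_norm_sum _ _ _))//.
    by apply: ler_sum => j _; rewrite normrM.
  apply: (le_trans (phi_incr (normr_ge0 _) yT)).
  have -> : T = A * (T / A) by rewrite mulrC divfK ?gt_eqF.
  apply: (le_trans (phiA _ (divr_ge0 T0 (ltW A0)))).
  rewrite addrA lerD2r -mulrA -mulrDr ler_wpM2l//.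
  rewrite -(ler_pM2l A0); apply: (le_trans jensen).
  rewrite mulrDr mulVKf ?gt_eqF// addrC lerD2l ler_wpM2r// ?phi_ge0//.
  by rewrite gerDl oppr_le0.
exists (C / A * B * M + (C * phi 0 + D)) => n.
apply: (le_trans (ler_sum _ (fun i _ => pointwise i))).
rewrite big_split/= sumr_const_nat subn0 mulrDl -[_ *+ n]mulr_natr lerD2r.
rewrite -mulr_sumr -!mulrA ler_wpM2l// ler_wpM2l ?invr_ge0 ?(ltW A0)//.
apply: (le_trans (sum_convolution_le n _ _)) => //.
by apply: ler_pM => //; apply: sumr_ge0.
Qed.

End PhiMeans.

(** * The equivalence *)

Theorem corollary1 (R : realType) (k r H x : R^nat) (xi : R) (phi : R -> R)
    (k_summable : (\sum_(0 <= n <oo) `|k n|%:E < +oo)%E)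
    (r_resolvent : resolvent k r)
    (r_summable : (\sum_(0 <= n <oo) `|r n|%:E < +oo)%E)
    (x_solution : volterra_solution k H xi x)
    (phi_ge0 : forall u, 0 <= u -> 0 <= phi u)
    (phi_increasing : forall u v, 0 <= u -> u <= v -> phi u <= phi v)
    (phi_convex : convex_function (`[0, +oo[%classic : set R) phi)
    (phi_ORV : O_regularly_varying phi) :
  bounded_phi_mean phi x <-> bounded_phi_mean phi H.
Proof.
pose f := convolution (volterra_kernel k) x.
have fH n : f n.+1 = H n.+1 := volterra_solution_forcing x_solution n.
have [Bk kB] := abs_summable_bounded k_summable.
have [Br rB] := abs_summable_bounded r_summable.
split=> [bx|bH].
  apply: (eq_bounded_phi_mean phi_ge0 fH).
  exact: (bounded_phi_mean_convolution phi_ge0 phi_increasing phi_convex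
    phi_ORV (volterra_kernel_bounded kB)).
have <- : convolution r f = x by apply/funext; exact: resolventK.
apply: (bounded_phi_mean_convolution phi_ge0 phi_increasing phi_convex
  phi_ORV rB).
by apply: (eq_bounded_phi_mean phi_ge0 _ bH) => n; rewrite fH.
Qed.
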